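(* Let $M$ be a compact oriented $3$-manifold with triangulated boundary, triangulated (extending the boundary triangulation) so that every tetrahedron has four distinct vertices, with generic coordinates assigned to the vertices. Let $\mathcal C,\mathcal D$ be any two sets of boundary edges with $|\mathcal C|=|\mathcal D|$. Then the sequence $$0\longrightarrow (dx_{\mathrm{inner}})\xrightarrow{f_2}(dl_{\mathrm{inner}},dl_{\mathcal C})\xrightarrow{f_3}(d\omega,d\alpha_{\mathcal D})\xrightarrow{f_4}(dx^*_{\mathrm{inner}})\longrightarrow 0$$ is an algebraic complex, i.e. $f_3\circ f_2=0$ and $f_4\circ f_3=0$.
   Context: Triangulations need not be combinatorial (repeated simplices in boundaries and several simplices with the same vertices are allowed), but the four vertices of each tetrahedron are distinct. Vertices are inner or boundary; an edge is a boundary edge if it lies entirely in $\partial M$, otherwise it is inner. Each vertex $A$ gets coordinates $(x_A,y_A,z_A)\in\mathbb R^3$ in general position; edge lengths are Euclidean distances $l_{AB}$; each tetrahedron $ABCD$ is written in positively oriented vertex order and has oriented volume $V_{ABCD}=\frac16\det(\overrightarrow{AB},\overrightarrow{AC},\overrightarrow{AD})$; its dihedral angles, as functions of its six edge lengths, carry the sign of its volume. For an inner edge $i$, $\omega_i=-\sum_k\varphi_i^{(k)}\bmod 2\pi$ (sum of signed dihedral angles at $i$ over the tetrahedra around $i$); for a boundary edge $i$, $\alpha_i$ is defined by the same formula. All lengths are regarded as independent variables. Spaces are column-vector spaces: $(dx_{\mathrm{inner}})$ and $(dx^*_{\mathrm{inner}})$ are indexed by the three coordinates of each inner vertex; $(dl_{\mathrm{inner}},dl_{\mathcal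 C})$ is indexed by all inner edges together with the edges of $\mathcal C$; $(d\omega,d\alpha_{\mathcal D})$ is indexed by all inner edges together with the edges of $\mathcal D$. $f_2$ is the Jacobian of the lengths of inner edges and edges of $\mathcal C$ with respect to the coordinates of inner vertices (boundary vertices fixed); $f_3$ is the matrix of partial derivatives of $\omega_i$ (inner $i$) and $\alpha_i$ ($i\in\mathcal D$) with respect to the lengths of inner edges and edges of $\mathcal C$, evaluated at the lengths coming from the coordinates; $f_4=-(f_2^{\mathcal D})^{\mathrm T}$, where $f_2^{\mathcal D}$ is the matrix defined as $f_2$ but with $\mathcal D$ in place of $\mathcal C$. *)

(* Defs.v *)
From HB Require Import structures.
From mathcomp Require Import all_boot all_order all_algebra all_fingroup.
From mathcomp Require Import all_classical all_reals all_analysis.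
Set Implicit Arguments.
Unset Strict Implicit.
Unset Printing Implicit Defensive.
Import Order.TTheory GRing.Theory Num.Theory.
Local Open Scope ring_scope.

(* Combinatorial data of a (not necessarily combinatorial) triangulation of  *)
(* a compact oriented 3-manifold with boundary.                              *)
(*  - tv t a : the vertex of t at local position a (positively oriented      *)
(*    order tv t 0, tv t 1, tv t 2, tv t 3);                                 *)
(*  - te t a b : the edge of t joining local vertices a and b (a <> b);      *)
(*  - glue t j = Some (t', s) : the face of t opposite local vertex j is     *)
(*    glued to the face of t' opposite local vertex s j, local vertex k of t *)
(*    being sent to local vertex s k of t'; glue t j = None : that face is a *)
(*    boundary triangle.                                                     *)
Record tri_data := TriData {
  nV : nat; nE : nat; nT : nat;
  tv : 'I_nT -> 'I_4 -> 'I_nV;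
  te : 'I_nT -> 'I_4 -> 'I_4 -> 'I_nE;
  ev1 : 'I_nE -> 'I_nV;
  ev2 : 'I_nE -> 'I_nV;
  glue : 'I_nT -> 'I_4 -> option ('I_nT * 'S_4)
}.

Section Combinatorics.
Variable T : tri_data.

Definition bdry_vertex (v : 'I_(nV T)) : bool :=
  [exists t, exists j : 'I_4, exists k : 'I_4,
     [&& glue t j == None, k != j & tv t k == v]].
Definition inner_vertex v := ~~ bdry_vertex v.

Definition bdry_edge (e : 'I_(nE T)) : bool :=
  [exists t, exists j : 'I_4, exists a : 'I_4, exists b : 'I_4,
     [&& glue t j == None, a != j, b != j, a != b & te t a b == e]].
Definition inner_edge e := ~~ bdry_edge e.

(* Oriented triangulated 3-dimensional pseudo-manifold structure:           *)
Definition oriented_tri3 : Prop :=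
  (forall t : 'I_(nT T), injective (tv t)) /\
      (forall (t : 'I_(nT T)) a b, a != b -> te t a b = te t b a) /\
      (forall (t : 'I_(nT T)) a b, a != b ->
         (ev1 (te t a b) = tv t a /\ ev2 (te t a b) = tv t b) \/
         (ev1 (te t a b) = tv t b /\ ev2 (te t a b) = tv t a)) /\
      (forall v : 'I_(nV T), exists t a, tv t a = v) /\
      (forall e : 'I_(nE T), exists t a b, a != b /\ te t a b = e) /\
      (* face gluings: an involution on face slots, compatible with vertices *)
      (* and edges, and orientation reversing on faces (odd permutations,    *)
      (* i.e. the orientations of the tetrahedra match M's orientation)      *)
      (forall (t : 'I_(nT T)) j t' s, glue t j = Some (t', s) ->
         [/\ (t', s j) != (t, j),
             glue t' (s j) = Some (t, (s^-1)%g),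
             (forall k, k != j -> tv t' (s k) = tv t k),
             (forall a b, a != j -> b != j -> a != b ->
                te t' (s a) (s b) = te t a b) &
             odd_perm s]).

End Combinatorics.

Section Geometry.
Variable R : realType.

Definition vol4 (A B C D : 'I_3 -> R) : R :=
  6^-1 * \det (\matrix_(i < 3, c < 3)
                 ((if i == 0 then B c else if i == 1 then C c else D c) - A c)).

Definition general_position n (x : 'I_n -> 'I_3 -> R) : Prop :=
  forall a b c d : 'I_n, uniq [:: a; b; c; d] -> vol4 (x a) (x b) (x c) (x d) != 0.

Definition dist (p q : 'I_3 -> R) : R := Num.sqrt (\sum_(c < 3) (p c - q c) ^+ 2).

(* cosine of the angle at vertex A of a triangle with side lengths          *)
(* lAB, lAC and opposite side lBC (law of cosines)                          *)
Definition cos_face (lAB lAC lBC : R) : R :=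
  (lAB ^+ 2 + lAC ^+ 2 - lBC ^+ 2) / (2 * lAB * lAC).
Definition sin_of_cos (c : R) : R := Num.sqrt (1 - c ^+ 2).

Definition other (a b : 'I_4) (n : nat) : 'I_4 :=
  nth ord0 [seq k <- enum 'I_4 | (k != a) && (k != b)] n.

(* unsigned dihedral angle at the edge ab of a Euclidean tetrahedron with    *)
(* edge lengths l p q (spherical law of cosines at the vertex a)             *)
Definition dihedral (l : 'I_4 -> 'I_4 -> R) (a b : 'I_4) : R :=
  let c := other a b 0 in let d := other a b 1 in
  let cbc := cos_face (l a b) (l a c) (l b c) in
  let cbd := cos_face (l a b) (l a d) (l b d) in
  let ccd := cos_face (l a c) (l a d) (l c d) in
  acos ((ccd - cbc * cbd) / (sin_of_cos cbc * sin_of_cos cbd)).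

End Geometry.

Section Complex.
Variables (R : realType) (T : tri_data) (x : 'I_(nV T) -> 'I_3 -> R).

Definition tet_vol (t : 'I_(nT T)) : R :=
  vol4 (x (tv t 0)) (x (tv t 1)) (x (tv t 2)) (x (tv t 3)).

Definition elen (y : 'I_(nV T) -> 'I_3 -> R) (e : 'I_(nE T)) : R :=
  dist (y (ev1 e)) (y (ev2 e)).

(* signed dihedral angle (sign of the volume, fixed by x) at local edge ab of *)
(* t, as a function of the (independent) edge lengths L                      *)
Definition sdihedral (L : 'I_(nE T) -> R) (t : 'I_(nT T)) (a b : 'I_4) : R :=
  Num.sg (tet_vol t) * dihedral (fun p q => L (te t p q)) a b.

(* omega_i (inner i) / alpha_i (boundary i): minus the sum of the signed    *)
(* dihedral angles at i over the tetrahedra around i (with multiplicity),    *)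
(* taken as a real representative (the mod 2pi does not affect derivatives) *)
Definition angle_defect (L : 'I_(nE T) -> R) (i : 'I_(nE T)) : R :=
  - \sum_(t < nT T) \sum_(a : 'I_4) \sum_(b : 'I_4 | (a < b)%N && (te t a b == i))
      sdihedral L t a b.

Definition f2 (k : 'I_(nE T)) (v : 'I_(nV T)) (c : 'I_3) : R :=
  derive1 (fun s : R => elen (fun w d => x w d + (if (w == v) && (d == c) then s else 0)) k) 0.

Definition f3 (i k : 'I_(nE T)) : R :=
  derive1 (fun s : R => angle_defect (fun e => elen x e + (if e == k then s else 0)) i) 0.

Definition f4 (v : 'I_(nV T)) (c : 'I_3) (j : 'I_(nE T)) : R := - f2 j v c.

End Complex.

(* Main.v *)
(* For one tetrahedron, the differential of a dihedral angle is a rational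
   expression in the squared edge lengths, and the resulting 6 x 6 Jacobian is
   symmetric (the Schlaefli symmetry); hence f3 is symmetric and f4 o f3 = 0 is
   the transpose of f3 o f2 = 0.  For the latter, when the vertices move, the
   signed dihedral angle at an edge AB of ABCD varies by the difference of the
   angular velocities about AB of its two faces ABD and ABC, each measured in
   the frame transported without twist along AB and so depending on that face
   only.  Summed over the tetrahedra, the contributions of glued faces cancel
   and those of boundary faces vanish because only an inner vertex moves. *)

Require Import Defs.
From HB Require Import structures.
From mathcomp Require Import all_boot all_order all_algebra all_fingroup.
From mathcomp Require Import all_classical all_reals all_analysis.
From mathcomp Require Import ring lra.
Import Order.TTheory GRing.Theory Num.Theory.
Import numFieldNormedType.Exports.
Local Open Scope ring_scope.
Set Implicit Arguments.
Unset Strict Implicit.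
Unset Printing Implicit Defensive.

(** * Algebra of one tetrahedron in its squared edge lengths *)

Section TetrahedronAlgebra.
Variable R : realFieldType.
Implicit Types p q r a b c d : R.

(* Sixteen times the squared area, in terms of the squared side lengths. *)
Definition heron p q r : R := 4 * p * q - (p + q - r) ^+ 2.
Definition dheron p q r p' q' r' : R :=
  4 * (p' * q + p * q') - 2 * (p + q - r) * (p' + q' - r').

(* The dihedral angle at [ab] has cosine [dihnum] over the product of the square
   roots of the [heron] of its two faces. *)
Definition dihnum ab ac ad bc bd cd : R :=
  2 * ab * (ac + ad - cd) - (ab + ac - bc) * (ab + ad - bd).
Definition ddihnum ab ac ad bc bd cd ab' ac' ad' bc' bd' cd' : R :=
  2 * ab' * (ac + ad - cd) + 2 * ab * (ac' + ad' - cd')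
  - (ab' + ac' - bc') * (ab + ad - bd) - (ab + ac - bc) * (ab' + ad' - bd').

(* [4 (6V)^2], by [cayley_triple] below. *)
Definition cayley ab ac ad bc bd cd : R :=
  let m := ab + ac - bc in let n := ab + ad - bd in let k := ac + ad - cd in
  4 * ab * ac * ad + m * n * k - ab * k ^+ 2 - ac * n ^+ 2 - ad * m ^+ 2.

(** This gives the squared sine of the dihedral angle at [ab]: dividing by the product of the two
    [heron] turns the left side into 1 - cos^2. *)
Lemma heron_dihnum ab ac ad bc bd cd :
  heron ab ac bc * heron ab ad bd - dihnum ab ac ad bc bd cd ^+ 2
  = 4 * ab * cayley ab ac ad bc bd cd.
Proof. rewrite /heron /dihnum /cayley; ring. Qed.

(* [- 4 l_ab |6V|] times the differential of the dihedral angle at [ab], the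
   arguments being squared lengths and their differentials. *)
Definition ddih ab ac ad bc bd cd ab' ac' ad' bc' bd' cd' : R :=
  ddihnum ab ac ad bc bd cd ab' ac' ad' bc' bd' cd'
  - dihnum ab ac ad bc bd cd / 2 *
    (dheron ab ac bc ab' ac' bc' / heron ab ac bc
     + dheron ab ad bd ab' ad' bd' / heron ab ad bd).

Lemma ddih_swap_ab ab ac ad bc bd cd ab' ac' ad' bc' bd' cd' :
  ddih ab bc bd ac ad cd ab' bc' bd' ac' ad' cd'
  = ddih ab ac ad bc bd cd ab' ac' ad' bc' bd' cd'.
Proof.
rewrite /ddih.
have hs p q r : heron p r q = heron p q r by rewrite /heron; ring.
have dhs p q r p' q' r' : dheron p r q p' r' q' = dheron p q r p' q' r'.
  by rewrite /dheron; ring.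
rewrite (hs ab ac bc) (hs ab ad bd) (dhs ab ac bc) (dhs ab ad bd).
congr (_ - _ / 2 * _); [rewrite /ddihnum|rewrite /dihnum]; ring.
Qed.

Lemma ddih_swap_cd ab ac ad bc bd cd ab' ac' ad' bc' bd' cd' :
  ddih ab ad ac bd bc cd ab' ad' ac' bd' bc' cd'
  = ddih ab ac ad bc bd cd ab' ac' ad' bc' bd' cd'.
Proof.
rewrite /ddih [X in _ / 2 * X]addrC.
congr (_ - _ / 2 * _); [rewrite /ddihnum|rewrite /dihnum]; ring.
Qed.

(* The coefficient of [dl_e] in the differential of the angle at [ab], for
   [e = ac] and [e = cd], is [- l_ab l_e / (2 |6V|)] times the following, which
   are symmetric under exchanging the edges [ab] and [e]. *)
Definition coef_adj ab ac ad bc bd cd : R :=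
  ddih ab ac ad bc bd cd 0 1 0 0 0 0 / ab.
Definition coef_opp ab ac ad bc bd cd : R :=
  ddih ab ac ad bc bd cd 0 0 0 0 0 1 / ab.

(** Of the two faces at [ab] only [abc] varies with [ac]. Its [heron], symmetric in the three sides,
    is also the denominator for the exchanged edges; what remains is a polynomial identity. *)
Lemma coef_adj_sym ab ac ad bc bd cd : ab != 0 -> ac != 0 ->
  heron ab ac bc != 0 ->
  coef_adj ac ab ad bc cd bd = coef_adj ab ac ad bc bd cd.
Proof.
move=> h1 h2 h3.
have h4 : heron ac ab bc != 0 by move: h3; rewrite /heron; congr (_ != _); ring.
have e0 p q r : dheron p q r 0 0 0 = 0 by rewrite /dheron; ring.
rewrite /coef_adj /ddih !e0 !mul0r !addr0.
move: h3 h4; rewrite /heron /ddihnum /dihnum /dheron => h3 h4.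
by field; rewrite h1 h2 h3.
Qed.

(** The edge [cd] lies in neither face at [ab], so the [heron] terms drop out and both sides equal
    -2. *)
Lemma coef_opp_sym ab ac ad bc bd cd : ab != 0 -> cd != 0 ->
  coef_opp cd ac bc ad bd ab = coef_opp ab ac ad bc bd cd.
Proof.
move=> h1 h2.
have e0 p q r : dheron p q r 0 0 0 = 0 by rewrite /dheron; ring.
rewrite /coef_opp /ddih !e0 !mul0r !addr0 /ddihnum.
by field; rewrite h1 h2.
Qed.

(** [ddih] is linear in the six differentials, and the two swaps carry each of the four edges
    adjacent to [ab] onto [ac]; hence two kinds of off-diagonal coefficients suffice. *)
Lemma ddih_coef ab ac ad bc bd cd ab' ac' ad' bc' bd' cd' :
  ddih ab ac ad bc bd cd ab' ac' ad' bc' bd' cd' / ab =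
  ddih ab ac ad bc bd cd 1 0 0 0 0 0 / ab * ab'
  + coef_adj ab ac ad bc bd cd * ac' + coef_adj ab ad ac bd bc cd * ad'
  + coef_adj ab bc bd ac ad cd * bc' + coef_adj ab bd bc ad ac cd * bd'
  + coef_opp ab ac ad bc bd cd * cd'.
Proof.
rewrite /coef_adj /coef_opp.
rewrite (ddih_swap_cd ab ac ad bc bd cd 0 0 1 0 0 0).
rewrite (ddih_swap_ab ab ac ad bc bd cd 0 0 0 1 0 0).
rewrite (ddih_swap_ab ab ad ac bd bc cd 0 0 0 1 0 0).
rewrite (ddih_swap_cd ab ac ad bc bd cd 0 0 0 0 1 0).
rewrite /ddih /ddihnum /dheron.
move: (ab^-1) (heron ab ac bc)^-1 (heron ab ad bd)^-1 (dihnum _ _ _ _ _ _) =>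
  i j k m.
ring.
Qed.

Lemma ddih_sum (I : finType) ab ac ad bc bd cd
    (w ab' ac' ad' bc' bd' cd' : I -> R) :
  \sum_i w i * (ddih ab ac ad bc bd cd
                  (ab' i) (ac' i) (ad' i) (bc' i) (bd' i) (cd' i) / ab)
  = ddih ab ac ad bc bd cd
      (\sum_i w i * ab' i) (\sum_i w i * ac' i) (\sum_i w i * ad' i)
      (\sum_i w i * bc' i) (\sum_i w i * bd' i) (\sum_i w i * cd' i) / ab.
Proof.
rewrite ddih_coef !mulr_sumr -!big_split; apply: eq_bigr => i _ /=.
rewrite ddih_coef; ring.
Qed.

End TetrahedronAlgebra.

(** * Tetrahedra in coordinates: Gram determinants, face rotations and positivity *)

Section TetrahedronGeometry.
Variable R : realFieldType.
Implicit Types A B C D X v w z : 'I_3 -> R.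

Definition dot v w : R := v 0 * w 0 + v 1 * w 1 + v 2%:R * w 2%:R.
Definition triple v w z : R :=
  v 0 * (w 1 * z 2%:R - w 2%:R * z 1) - v 1 * (w 0 * z 2%:R - w 2%:R * z 0)
  + v 2%:R * (w 0 * z 1 - w 1 * z 0).
Definition sqd A B : R := dot (A - B) (A - B).
Definition dsqd A B A' B' : R := 2 * dot (A - B) (A' - B').

(** Multiplicativity of the determinant: det M det N = det (M N^T), whose entries are dot
    products. *)
Lemma triple_gram v w z v' w' z' :
  triple v w z * triple v' w' z' =
  dot v v' * (dot w w' * dot z z' - dot w z' * dot z w')
  - dot v w' * (dot w v' * dot z z' - dot w z' * dot z v')
  + dot v z' * (dot w v' * dot z w' - dot w w' * dot z v').
Proof. rewrite /triple /dot; ring. Qed.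

Lemma sqdC A B : sqd A B = sqd B A.
Proof. rewrite /sqd /dot !fctE; ring. Qed.

Lemma dsqdC A B A' B' : dsqd A B A' B' = dsqd B A B' A'.
Proof. rewrite /dsqd /dot !fctE; ring. Qed.

Lemma sqd_ge0 A B : 0 <= sqd A B.
Proof. by rewrite /sqd /dot -!expr2 !addr_ge0 ?sqr_ge0. Qed.

(* [l_AB] times the angular velocity, about the axis [AB], of the half-plane
   through [X], measured in the frame transported without twist along [AB]. *)
Definition twist A B X A' B' X' : R :=
  (sqd A B * triple (B - A) (X - A) (X' - A')
   - dot (B - A) (X - A) * triple (B - A) (X - A) (B' - A'))
  * 4 / heron (sqd A B) (sqd A X) (sqd B X).

Lemma twist0 A B X : twist A B X 0 0 0 = 0.
Proof.
by rewrite /twist /triple !fctE !subr0 !(mulr0, mul0r, subrr, addr0).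
Qed.

(** The quantities m, n, k of [cayley] are twice the dot products of the edge vectors at [A], so
    [cayley] is four times their Gram determinant. *)
Lemma cayley_triple A B C D :
  cayley (sqd A B) (sqd A C) (sqd A D) (sqd B C) (sqd B D) (sqd C D)
  = 4 * triple (B - A) (C - A) (D - A) ^+ 2.
Proof. rewrite expr2 /cayley /triple /sqd /dot !fctE; ring. Qed.

(** The dihedral angle is the angle between the half-planes of its two faces, so it varies by the
    difference of their rotations about [AB]. With all vectors based at [A], both sides become
    rational functions of dot products. *)
Lemma ddih_twist A B C D A' B' C' D' :
  heron (sqd A B) (sqd A C) (sqd B C) != 0 ->
  heron (sqd A B) (sqd A D) (sqd B D) != 0 ->
  ddih (sqd A B) (sqd A C) (sqd A D) (sqd B C) (sqd B D) (sqd C D)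
    (dsqd A B A' B') (dsqd A C A' C') (dsqd A D A' D')
    (dsqd B C B' C') (dsqd B D B' D') (dsqd C D C' D')
  = - 4 * triple (B - A) (C - A) (D - A)
    * (twist A B D A' B' D' - twist A B C A' B' C').
Proof.
rewrite /twist.
pose b := B - A; pose c := C - A; pose d := D - A.
pose b' := B' - A'; pose c' := C' - A'; pose d' := D' - A'.
have sqdE (Y Z : 'I_3 -> R) :
  sqd Y Z = dot (Y - A) (Y - A) + dot (Z - A) (Z - A) - 2 * dot (Y - A) (Z - A).
  rewrite /sqd /dot !fctE; ring.
have dsqdE (Y Z Y' Z' : 'I_3 -> R) : dsqd Y Z Y' Z' =
  2 * (dot (Y - A) (Y' - A') + dot (Z - A) (Z' - A')
       - dot (Y - A) (Z' - A') - dot (Z - A) (Y' - A')).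
  rewrite /dsqd /dot !fctE; ring.
have sqdAE (Y : 'I_3 -> R) : sqd A Y = dot (Y - A) (Y - A).
  rewrite /sqd /dot !fctE; ring.
have dsqdAE (Y Y' : 'I_3 -> R) : dsqd A Y A' Y' = 2 * dot (Y - A) (Y' - A').
  rewrite /dsqd /dot !fctE; ring.
rewrite !sqdAE !dsqdAE !sqdE !dsqdE -/b -/c -/d -/b' -/c' -/d'.
have dC v w : dot v w = dot w v by rewrite /dot; ring.
move=> K1 K2.
(* Moving the volume factor inside makes each triple product of a twist part of a product of two, to
   which [triple_gram] applies. *)
have -> (x1 x2 x3 k1 k2 s1 s2 s3 s4 V : R) :
    - 4 * V * ((x1 * s1 - x2 * s2) * 4 / k1 - (x1 * s3 - x3 * s4) * 4 / k2)
    = - 4 * ((x1 * (V * s1) - x2 * (V * s2)) * 4 / k1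
             - (x1 * (V * s3) - x3 * (V * s4)) * 4 / k2) by ring.
rewrite !triple_gram (dC c b) (dC d b) (dC d c).
move: K1 K2; rewrite /ddih /ddihnum /dihnum /dheron /heron.
move: (dot b b) (dot b c) (dot b d) (dot c c) (dot c d) (dot d d)
 (dot b b') (dot b c') (dot b d') (dot c b') (dot c c') (dot c d')
 (dot d b') (dot d c') (dot d d') =>
  bb bc bd cc cd dd bb' bc' bd' cb' cc' cd' db' dc' dd' K1 K2.
by field; rewrite K1 K2.
Qed.
Lemma sqd_gt0 A B v w : triple (B - A) v w != 0 -> 0 < sqd A B.
Proof.
rewrite lt0r sqd_ge0 andbT; apply: contra_neq; rewrite sqdC /sqd /dot -!expr2.
move/eqP; rewrite !paddr_eq0 ?addr_ge0 ?sqr_ge0 // !sqrf_eq0.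
by case/andP=> /andP[/eqP e0 /eqP e1] /eqP e2; rewrite /triple e0 e1 e2; ring.
Qed.

(** Lagrange's identity: [heron] is four times the squared norm of the cross product of two sides,
    whose components up to sign are [n]. *)
Lemma heron_ge0 A B C : 0 <= heron (sqd A B) (sqd A C) (sqd B C).
Proof.
pose n i j := (B - A) i * (C - A) j - (B - A) j * (C - A) i.
have -> : heron (sqd A B) (sqd A C) (sqd B C)
    = 4 * (n 0 1 ^+ 2 + n 0 2%:R ^+ 2 + n 1 2%:R ^+ 2).
  by rewrite /heron /sqd /dot /n !fctE; ring.
by rewrite mulr_ge0 // !addr_ge0 // sqr_ge0.
Qed.

(** By [heron_dihnum] the product of the two [heron] is a positive multiple of the squared volume
    plus a square, so neither nonnegative factor can vanish. *)
Lemma heron_gt0 A B C D : triple (B - A) (C - A) (D - A) != 0 ->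
  0 < heron (sqd A B) (sqd A C) (sqd B C) /\
  0 < heron (sqd A B) (sqd A D) (sqd B D).
Proof.
move=> V0; have ab0 := sqd_gt0 V0.
have := heron_dihnum (sqd A B) (sqd A C) (sqd A D) (sqd B C) (sqd B D)
  (sqd C D).
rewrite cayley_triple => /eqP; rewrite subr_eq => /eqP e.
have K : 0 < heron (sqd A B) (sqd A C) (sqd B C)
             * heron (sqd A B) (sqd A D) (sqd B D).
  rewrite e.
  have t2 : 0 < triple (B - A) (C - A) (D - A) ^+ 2.
    by rewrite exprn_even_gt0.
  by apply: ltr_pwDl (sqr_ge0 _); apply: mulr_gt0; apply: mulr_gt0.
by split; rewrite lt0r heron_ge0 andbT; apply: contraTneq K => ->;
  rewrite ?mul0r ?mulr0 ltxx.
Qed.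

End TetrahedronGeometry.

(** * Derivative of a dihedral angle along curves of edge lengths *)

Section DihedralDerivative.
Variable R : realType.

Definition dihedral6 (ab ac ad bc bd cd : R) : R :=
  acos ((cos_face ac ad cd - cos_face ab ac bc * cos_face ab ad bd) /
        (sin_of_cos (cos_face ab ac bc) * sin_of_cos (cos_face ab ad bd))).

Lemma sin_of_cos_face (ab ac bc : R) : 0 < ab -> 0 < ac ->
  sin_of_cos (cos_face ab ac bc)
  = Num.sqrt (heron (ab ^+ 2) (ac ^+ 2) (bc ^+ 2)) / (2 * ab * ac).
Proof.
move=> ab0 ac0; rewrite /sin_of_cos /cos_face.
have w0 : 0 <= (2 * ab * ac)^-1 by rewrite invr_ge0 !mulr_ge0 // ltW.
have wE : (2 * ab * ac)^-1 = Num.sqrt ((2 * ab * ac)^-1 ^+ 2).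
  by rewrite sqrtr_sqr ger0_norm.
rewrite [RHS]mulrC [X in _ = X * _]wE -sqrtrM ?sqr_ge0 //.
congr Num.sqrt; rewrite /heron.
by field; rewrite !gt_eqF.
Qed.

Lemma dihedral6E (ab ac ad bc bd cd : R) : 0 < ab -> 0 < ac -> 0 < ad ->
  dihedral6 ab ac ad bc bd cd =
  acos (dihnum (ab ^+ 2) (ac ^+ 2) (ad ^+ 2) (bc ^+ 2) (bd ^+ 2) (cd ^+ 2)
        * (Num.sqrt (heron (ab ^+ 2) (ac ^+ 2) (bc ^+ 2)))^-1
        * (Num.sqrt (heron (ab ^+ 2) (ad ^+ 2) (bd ^+ 2)))^-1).
Proof.
move=> ab0 ac0 ad0; rewrite /dihedral6 !sin_of_cos_face //; congr acos.
rewrite (invfM (_ / _)) !invf_div.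
move: (Num.sqrt _)^-1 (Num.sqrt _)^-1 => i j.
rewrite /dihnum /cos_face.
by field; rewrite !gt_eqF.
Qed.

Lemma is_derive_gt0 (f : R -> R) (f' : R) :
  is_derive (0 : R) 1 f f' -> 0 < f 0 -> \forall s \near (0 : R), 0 < f s.
Proof.
move=> [/derivable1_diffP/differentiable_continuous fc _] f0.
exact: (cvgr_gt _ fc).
Qed.

Lemma is_derive_invsqrt (f : R -> R) (s f' : R) : 0 < f s ->
  is_derive s 1 f f' ->
  is_derive s 1 (fun r => (Num.sqrt (f r))^-1)
    (- f' / (2 * f s * Num.sqrt (f s))).
Proof.
move=> f0 df.
have dsq := is_derive1_comp (is_derive1_sqrt f0) df.
have sq0 : Num.sqrt (f s) != 0 by rewrite sqrtr_eq0 -ltNge.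
apply: is_derive_eq (is_deriveV (f := Num.sqrt \o f) sq0 dsq) _ => /=.
rewrite -[X in _ = _ / (2 * X * _)](sqr_sqrtr (ltW f0)) /GRing.scale /=.
by field.
Qed.

(** Chain rule through [acos]. By [heron_dihnum] the sine is 2 l_ab sqrt(cayley) over the roots of
    the two [heron], and these roots cancel against those in the derivative of the cosine. *)
Lemma is_derive_dihedral6 (ab ac ad bc bd cd : R -> R)
    (ab' ac' ad' bc' bd' cd' : R) :
  is_derive (0 : R) 1 ab ab' -> is_derive (0 : R) 1 ac ac' ->
  is_derive (0 : R) 1 ad ad' -> is_derive (0 : R) 1 bc bc' ->
  is_derive (0 : R) 1 bd bd' -> is_derive (0 : R) 1 cd cd' ->
  0 < ab 0 -> 0 < ac 0 -> 0 < ad 0 ->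
  0 < heron (ab 0 ^+ 2) (ac 0 ^+ 2) (bc 0 ^+ 2) ->
  0 < heron (ab 0 ^+ 2) (ad 0 ^+ 2) (bd 0 ^+ 2) ->
  0 < cayley (ab 0 ^+ 2) (ac 0 ^+ 2) (ad 0 ^+ 2) (bc 0 ^+ 2) (bd 0 ^+ 2)
        (cd 0 ^+ 2) ->
  is_derive (0 : R) 1
    (fun s => dihedral6 (ab s) (ac s) (ad s) (bc s) (bd s) (cd s))
    (- ddih (ab 0 ^+ 2) (ac 0 ^+ 2) (ad 0 ^+ 2) (bc 0 ^+ 2) (bd 0 ^+ 2)
         (cd 0 ^+ 2) (2 * ab 0 * ab') (2 * ac 0 * ac') (2 * ad 0 * ad')
         (2 * bc 0 * bc') (2 * bd 0 * bd') (2 * cd 0 * cd')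
       / (2 * ab 0 * Num.sqrt (cayley (ab 0 ^+ 2) (ac 0 ^+ 2) (ad 0 ^+ 2)
                                 (bc 0 ^+ 2) (bd 0 ^+ 2) (cd 0 ^+ 2)))).
Proof.
move=> dab dac dad dbc dbd dcd ab0 ac0 ad0 K1 K2 G0.
pose h1 := (fun s => heron (ab s ^+ 2) (ac s ^+ 2) (bc s ^+ 2)).
pose h2 := (fun s => heron (ab s ^+ 2) (ad s ^+ 2) (bd s ^+ 2)).
pose m := (fun s => dihnum (ab s ^+ 2) (ac s ^+ 2) (ad s ^+ 2)
                      (bc s ^+ 2) (bd s ^+ 2) (cd s ^+ 2)).
(* [dihedral6E] requires positive lengths; by continuity they stay positive near 0, which is enough
   for a derivative. *)
apply: (@near_eq_is_derive _ _ _
  (acos \o (fun s => m s * (Num.sqrt (h1 s))^-1 * (Num.sqrt (h2 s))^-1))).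
  have := is_derive_gt0 dad ad0.
  have := is_derive_gt0 dac ac0.
  have := is_derive_gt0 dab ab0.
  by apply: filterS3 => s ? ? ? /=; rewrite dihedral6E.
have dh (p q r : R -> R) p' q' r' : is_derive (0 : R) 1 p p' ->
   is_derive (0 : R) 1 q q' -> is_derive (0 : R) 1 r r' ->
   is_derive (0 : R) 1 (fun s => heron (p s ^+ 2) (q s ^+ 2) (r s ^+ 2))
    (dheron (p 0 ^+ 2) (q 0 ^+ 2) (r 0 ^+ 2)
       (2 * p 0 * p') (2 * q 0 * q') (2 * r 0 * r')).
  move=> dp dq dr; rewrite /heron; under eq_fun do rewrite !expr2.
  by apply: is_derive_eq; rewrite /dheron /GRing.scale /=; ring.
have dh1 : is_derive (0 : R) 1 h1 _ := dh _ _ _ _ _ _ dab dac dbc.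
have dh2 : is_derive (0 : R) 1 h2 _ := dh _ _ _ _ _ _ dab dad dbd.
have dm : is_derive (0 : R) 1 m
  (ddihnum (ab 0 ^+ 2) (ac 0 ^+ 2) (ad 0 ^+ 2) (bc 0 ^+ 2) (bd 0 ^+ 2)
         (cd 0 ^+ 2) (2 * ab 0 * ab') (2 * ac 0 * ac') (2 * ad 0 * ad')
         (2 * bc 0 * bc') (2 * bd 0 * bd') (2 * cd 0 * cd')).
  rewrite /m /dihnum; under eq_fun do rewrite !expr2.
  by apply: is_derive_eq; rewrite /ddihnum /GRing.scale /=; ring.
(* A tetrahedron that is not flat keeps the cosine strictly between -1 and 1, where [acos] is
   differentiable. *)
have K : 0 < h1 0 * h2 0 - m 0 ^+ 2.
  rewrite heron_dihnum; apply: mulr_gt0 => //.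
  by rewrite mulr_gt0 // exprn_gt0.
have s1 : 0 < Num.sqrt (h1 0) by rewrite sqrtr_gt0.
have s2 : 0 < Num.sqrt (h2 0) by rewrite sqrtr_gt0.
have q1 : Num.sqrt (h1 0) ^+ 2 = h1 0 := sqr_sqrtr (ltW K1).
have q2 : Num.sqrt (h2 0) ^+ 2 = h2 0 := sqr_sqrtr (ltW K2).
set y := (X in acos \o X).
have y1E : 1 - y 0 ^+ 2 = (h1 0 * h2 0 - m 0 ^+ 2) / (h1 0 * h2 0).
  by rewrite -q1 -q2 /y; field; rewrite !gt_eqF.
have y1 : 0 < 1 - y 0 ^+ 2 by rewrite y1E divr_gt0 // mulr_gt0.
have yI : -1 < y 0 < 1 by apply/andP; nra.
have dy : is_derive (0 : R) 1 y _ :=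
  is_deriveM (is_deriveM dm (is_derive_invsqrt (f := h1) K1 dh1))
    (is_derive_invsqrt (f := h2) K2 dh2).
apply: is_derive_eq (is_derive1_comp (is_derive1_acos yI) dy) _.
set g := cayley _ _ _ _ _ _.
have -> : 1 - y 0 ^+ 2
    = (2 * ab 0 / (Num.sqrt (h1 0) * Num.sqrt (h2 0))) ^+ 2 * g.
  rewrite y1E heron_dihnum -/g; move: s1 s2 q1 q2.
  move: (Num.sqrt (h1 0)) (Num.sqrt (h2 0)) => r1 r2 s1 s2 <- <-.
  by field; rewrite !gt_eqF.
rewrite sqrtrM ?sqr_ge0 // sqrtr_sqr ger0_norm; last first.
  by rewrite divr_ge0 ?mulr_ge0 ?sqrtr_ge0 ?ltW.
have : 0 < Num.sqrt g by rewrite sqrtr_gt0.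
rewrite /ddih -/(h1 0) -/(h2 0) -/(m 0) /GRing.scale /=.
have -> : (m * (fun r => (Num.sqrt (h1 r))^-1)) 0 = m 0 / Num.sqrt (h1 0) by [].
move: (Num.sqrt g) (ddihnum _ _ _ _ _ _ _ _ _ _ _ _) => rg n rg0.
move: (dheron _ _ _ _ _ _) (dheron _ _ _ _ _ _) (m 0) => k1 k2 m0.
move: s1 s2 q1 q2; move: (Num.sqrt (h1 0)) (Num.sqrt (h2 0)) => r1 r2 s1 s2.
move=> <- <-.
by field; rewrite !gt_eqF.
Qed.
End DihedralDerivative.

(** * Oriented volume under permutations of the vertices *)

Section OrientedVolume.
Variable R : realType.

Definition det3_nat (m : nat -> nat -> R) : R :=
  m 0%N 0%N * (m 1%N 1%N * m 2%N 2%N - m 1%N 2%N * m 2%N 1%N)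
  - m 0%N 1%N * (m 1%N 0%N * m 2%N 2%N - m 1%N 2%N * m 2%N 0%N)
  + m 0%N 2%N * (m 1%N 0%N * m 2%N 1%N - m 1%N 1%N * m 2%N 0%N).

Lemma det3 (m : nat -> nat -> R) :
  \det (\matrix_(i < 3, j < 3) m i j) = det3_nat m.
Proof.
rewrite (expand_det_row _ 0) !big_ord_recl big_ord0 /cofactor.
rewrite !(expand_det_row _ 0) !big_ord_recl !big_ord0 /cofactor !det_mx11 !mxE.
rewrite /= /bump /= !expr0 !expr1 !exprS /det3_nat.
ring.
Qed.

Lemma det4 (m : nat -> nat -> R) :
  \det (\matrix_(i < 4, j < 4) m i j) =
  \sum_(j < 4) m 0%N j * ((-1) ^+ j *
     det3_nat (fun i k => m i.+1 (bump j k))).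
Proof.
rewrite (expand_det_row _ 0); apply: eq_bigr => j _; rewrite mxE; congr (_ * _).
rewrite /cofactor -det3; congr (_ * \det _).
by apply/matrixP => i k; rewrite !mxE.
Qed.

Lemma vol4E (A B C D : 'I_3 -> R) :
  vol4 A B C D = 6^-1 * triple (B - A) (C - A) (D - A).
Proof.
rewrite /vol4; congr (_ * _).
pose m i j := (nth A [:: B; C; D] i - A) (inord j : 'I_3).
transitivity (\det (\matrix_(i < 3, j < 3) m i j)).
  congr (\det _); apply/matrixP => i j; rewrite !mxE /m !fctE inord_val.
  by case: i => [[|[|[|]]]].
have e0 : inord 0 = 0 :> 'I_3 by apply/val_inj; rewrite /= inordK.
have e1 : inord 1 = 1 :> 'I_3 by apply/val_inj; rewrite /= inordK.
have e2 : inord 2 = 2%:R :> 'I_3 by apply/val_inj; rewrite /= inordK.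
by rewrite det3 /det3_nat /triple /m /= e0 e1 e2.
Qed.

(** The triple product is the determinant of the 4 x 4 matrix [M P] with rows (1, P i), and renaming
    the vertices permutes these rows. *)
Lemma triple_perm (P : 'I_4 -> 'I_3 -> R) (s : 'S_4) :
  triple (P (s 1) - P (s 0)) (P (s 2%:R) - P (s 0)) (P (s 3%:R) - P (s 0))
  = (-1) ^+ s * triple (P 1 - P 0) (P 2%:R - P 0) (P 3%:R - P 0).
Proof.
pose M (Q : 'I_4 -> 'I_3 -> R) : 'M[R]_4 :=
  \matrix_(i < 4, j < 4) (if unlift 0 j is Some k then Q i k else 1).
have detM Q : \det (M Q) = triple (Q 1 - Q 0) (Q 2%:R - Q 0) (Q 3%:R - Q 0).
  pose m i j :=
    if j is k.+1 then Q (inord i : 'I_4) (inord k : 'I_3) else 1.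
  transitivity (\det (\matrix_(i < 4, j < 4) m i j)).
    congr (\det _); apply/matrixP => i j; rewrite !mxE /m inord_val.
    case: unliftP => [k ->|->] //=.
    by rewrite /bump /= inord_val.
  have e0 : inord 0 = 0 :> 'I_3 by apply/val_inj; rewrite /= inordK.
  have e1 : inord 1 = 1 :> 'I_3 by apply/val_inj; rewrite /= inordK.
  have e2 : inord 2 = 2%:R :> 'I_3 by apply/val_inj; rewrite /= inordK.
  have f0 : inord 0 = 0 :> 'I_4 by apply/val_inj; rewrite /= inordK.
  have f1 : inord 1 = 1 :> 'I_4 by apply/val_inj; rewrite /= inordK.
  have f2 : inord 2 = 2%:R :> 'I_4 by apply/val_inj; rewrite /= inordK.
  have f3 : inord 3 = 3%:R :> 'I_4 by apply/val_inj; rewrite /= inordK.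
  rewrite det4 !big_ord_recl big_ord0.
  rewrite /det3_nat /m /= /bump /= e0 e1 e2 f0 f1 f2 f3.
  rewrite /triple !fctE !exprS expr0; ring.
rewrite -(detM (P \o s)) -(detM P) -det_perm -det_mulmx -row_permE.
by congr (\det _); apply/matrixP => i j; rewrite !mxE.
Qed.

End OrientedVolume.

(** * Sums over edges as sums over S_4, and the Schlaefli symmetry of one tetrahedron *)

Section PermutationSums.
Variable R : realFieldType.

Lemma enum_ord4 : enum 'I_4 = [:: 0; 1; 2%:R; 3%:R].
Proof. by apply: (inj_map val_inj); rewrite val_enum_ord. Qed.

Lemma uniq_other (a b : 'I_4) :
  a != b -> uniq [:: a; b; other a b 0; other a b 1].
Proof.
rewrite /other enum_ord4.
by case: a b => [[|[|[|[|]]]] ?] // [[|[|[|[|]]]] ?].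
Qed.

Lemma otherC (a b : 'I_4) n : other a b n = other b a n.
Proof.
by rewrite /other; congr nth; apply: eq_filter => k; rewrite andbC.
Qed.

Lemma perm4P (s s' : 'S_4) : s 0 = s' 0 -> s 1 = s' 1 -> s 2%:R = s' 2%:R ->
  s 3%:R = s' 3%:R -> s = s'.
Proof.
move=> e0 e1 e2 e3; apply/permP => k; have := mem_enum 'I_4 k.
by rewrite enum_ord4 !inE => /or4P[] /eqP ->.
Qed.

Lemma perm4_uniq (s : 'S_4) : uniq [:: s 0; s 1; s 2%:R; s 3%:R].
Proof.
rewrite -[X in uniq X]/(map s [:: 0; 1; 2%:R; 3%:R]) map_inj_uniq //.
exact: perm_inj.
Qed.

Lemma perm4_exists (a b c d : 'I_4) : uniq [:: a; b; c; d] ->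
  exists s : 'S_4, [/\ s 0 = a, s 1 = b, s 2%:R = c & s 3%:R = d].
Proof.
move=> abcd; pose f (k : 'I_4) := nth 0 [:: a; b; c; d] k.
have fI : injective f.
  by move=> j k /eqP; rewrite nth_uniq // => /eqP/val_inj.
by exists (perm fI); rewrite !permE.
Qed.

Lemma mem_uniq4 (a b c d k : 'I_4) :
  uniq [:: a; b; c; d] -> k \in [:: a; b; c; d].
Proof.
move=> abcd; have card4 : #|[:: a; b; c; d]| = #|'I_4|.
  by rewrite (card_uniqP abcd) card_ord.
suff -> : [:: a; b; c; d] =i 'I_4 by [].
by apply/(subset_cardP card4); apply: subset_predT.
Qed.

(** Exactly two permutations start with [a], [b]; they differ by exchanging [c] and [d], under which
    [F] is unchanged. *)
Lemma sum_perm4_prefix (F : 'I_4 -> 'I_4 -> 'I_4 -> 'I_4 -> R)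
    (a b c d : 'I_4) : uniq [:: a; b; c; d] -> F a b d c = F a b c d ->
  \sum_(s : 'S_4 | (s 0 == a) && (s 1 == b)) F (s 0) (s 1) (s 2%:R) (s 3%:R)
  = 2 * F a b c d.
Proof.
move=> abcd FC; have [r [r0 r1 r2 r3]] := perm4_exists abcd.
have abdc : uniq [:: a; b; d; c].
  rewrite -(perm_uniq (s1 := [:: a; b; c; d])) //.
  by rewrite !perm_cons (perm_catC [:: c]).
have [q [q0 q1 q2 q3]] := perm4_exists abdc.
have rq : r != q.
  apply: contraTneq abcd => rq; move: q2; rewrite -rq r2 => ->.
  by rewrite /= !inE eqxx /= !andbF.
rewrite (bigD1 r) ?r0 ?r1 ?eqxx //= (bigD1 q) ?q0 ?q1 ?eqxx ?(eq_sym q) //=.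
rewrite r2 r3 q2 q3 FC big1 ?addr0; first by ring.
move=> s /andP[/andP[/andP[/eqP s0 /eqP s1] sr] sq]; exfalso.
have := perm4_uniq s; rewrite s0 s1 => us.
have : s 2%:R \in [:: a; b; c; d] /\ s 3%:R \in [:: a; b; c; d].
  by rewrite !mem_uniq4.
move: us; rewrite /= !inE !negb_or.
case/and4P=> /and3P[_ a2 a3] /andP[b2 b3] n23 _.
rewrite !(eq_sym _ a) !(eq_sym _ b).
rewrite (negPf a2) (negPf a3) (negPf b2) (negPf b3) /=.
case=> /orP[] /eqP e2 /orP[] /eqP e3.
- by rewrite e2 e3 eqxx in n23.
- by move/eqP: sr; apply; apply: perm4P; rewrite ?s0 ?s1 ?e2 ?e3.
- by move/eqP: sq; apply; apply: perm4P; rewrite ?s0 ?s1 ?e2 ?e3.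
- by rewrite e2 e3 eqxx in n23.
Qed.

Lemma sum_lt_sym n (H : 'I_n -> 'I_n -> R) :
  (forall a, H a a = 0) -> (forall a b, H a b = H b a) ->
  \sum_a \sum_b H a b = 2 * \sum_(a < n) \sum_(b < n | (a < b)%N) H a b.
Proof.
move=> H0 HC.
have -> : \sum_a \sum_b H a b
  = \sum_(a < n) \sum_(b < n | (a < b)%N) H a b
    + \sum_(a < n) \sum_(b < n | (b < a)%N) H a b.
  rewrite -big_split; apply: eq_bigr => a _ /=.
  rewrite (bigID (fun b : 'I_n => (a < b)%N)) /=; congr (_ + _).
  rewrite big_mkcond [RHS]big_mkcond; apply: eq_bigr => b _.
  by case: ltngtP => // /val_inj ->; rewrite H0.
rewrite [X in _ + X](exchange_big_dep predT) //=.
under [X in _ + X]eq_bigr => a _ do under eq_bigr => b _ do rewrite HC.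
by rewrite mulr_natl mulr2n.
Qed.

(** Each edge comes from four permutations: two orders of its ends times two orders of the opposite
    vertices. *)
Lemma sum_edges_perm4 (F : 'I_4 -> 'I_4 -> 'I_4 -> 'I_4 -> R) :
  (forall a b c d, uniq [:: a; b; c; d] -> F b a c d = F a b c d) ->
  (forall a b c d, uniq [:: a; b; c; d] -> F a b d c = F a b c d) ->
  \sum_(s : 'S_4) F (s 0) (s 1) (s 2%:R) (s 3%:R) =
  4 * \sum_(a < 4) \sum_(b < 4 | (a < b)%N) F a b (other a b 0) (other a b 1).
Proof.
move=> Fab Fcd.
(* The diagonal value is 0 because no permutation sends positions 0 and 1 to the same vertex. *)
pose H a b := if a == b then 0 else 2 * F a b (other a b 0) (other a b 1).
transitivity (\sum_a \sum_b H a b).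
  rewrite (partition_big (fun s : 'S_4 => s 0) predT) //=.
  apply: eq_bigr => a _.
  rewrite (partition_big (fun s : 'S_4 => s 1) predT) //=.
  apply: eq_bigr => b _; rewrite /H; case: eqVneq => [->|ab].
    rewrite big_pred0 // => s; apply/negP => /andP[/eqP <-] /eqP/perm_inj.
    by move/eqP.
  by rewrite (sum_perm4_prefix (uniq_other ab)) // Fcd // uniq_other.
rewrite sum_lt_sym.
- rewrite -[4]/((2 * 2)%:R) natrM -mulrA; congr (_ * _).
  rewrite mulr_sumr; apply: eq_bigr => a _; rewrite mulr_sumr.
  by apply: eq_bigr => b ab; rewrite /H -val_eqE /= ltn_eqF.
- by move=> a; rewrite /H eqxx.
- move=> a b; rewrite /H [b == a]eq_sym; case: eqVneq => // ab.
  by rewrite !(otherC b a) [F b a _ _]Fab ?uniq_other.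
Qed.

Definition ddih4 (u z : 'I_4 -> 'I_4 -> R) (a b c d : 'I_4) : R :=
  ddih (u a b) (u a c) (u a d) (u b c) (u b d) (u c d)
    (z a b) (z a c) (z a d) (z b c) (z b d) (z c d).

Lemma ddih4_swap_ab (u z : 'I_4 -> 'I_4 -> R) (a b c d : 'I_4) :
  u a b = u b a -> z a b = z b a -> ddih4 u z b a c d = ddih4 u z a b c d.
Proof. by move=> uC zC; rewrite /ddih4 -uC -zC ddih_swap_ab. Qed.

Lemma ddih4_swap_cd (u z : 'I_4 -> 'I_4 -> R) (a b c d : 'I_4) :
  u c d = u d c -> z c d = z d c -> ddih4 u z a b d c = ddih4 u z a b c d.
Proof. by move=> uC zC; rewrite /ddih4 -uC -zC ddih_swap_cd. Qed.

(** Reindexing by [t], which exchanges the position pairs {0, 1} and {p, q}, swaps the roles of [y]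
    and [z] and preserves the weight [c]. *)
Lemma sum_perm4_edge_swap (c : 'S_4 -> R) (y z : 'I_4 -> 'I_4 -> R) (t : 'S_4)
    (p q : 'I_4) :
  (forall a b, a != b -> y a b = y b a) ->
  (forall a b, a != b -> z a b = z b a) ->
  (t 0 = p /\ t 1 = q) \/ (t 0 = q /\ t 1 = p) ->
  (t p = 0 /\ t q = 1) \/ (t p = 1 /\ t q = 0) ->
  (forall s, c (t * s)%g = c s) ->
  \sum_(s : 'S_4) c s * y (s 0) (s 1) * z (s p) (s q)
  = \sum_(s : 'S_4) c s * z (s 0) (s 1) * y (s p) (s q).
Proof.
move=> yC zC t01 tpq cE.
have pq : p != q by apply/eqP => e; case: tpq => -[tp]; rewrite -e tp.
rewrite (reindex_inj (mulgI t)); apply: eq_bigr => s _.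
rewrite cE !permM mulrAC; congr (_ * _ * _).
- case: tpq => -[-> ->] //; apply: zC.
  by rewrite (inj_eq perm_inj).
- case: t01 => -[-> ->] //; apply: yC.
  by rewrite (inj_eq perm_inj) eq_sym.
Qed.

(** After expansion by [ddih_coef] the [ab] term is visibly symmetric. For each other edge a
    permutation of positions exchanges it with {0, 1}: a transposition fixing the shared vertex if
    adjacent, a double transposition if opposite. *)
Lemma ddih4_bilinear_sym (u y z : 'I_4 -> 'I_4 -> R) :
  (forall a b, u a b = u b a) ->
  (forall a b, a != b -> y a b = y b a) ->
  (forall a b, a != b -> z a b = z b a) ->
  (forall a b, a != b -> u a b != 0) ->
  (forall a b c, uniq [:: a; b; c] -> heron (u a b) (u a c) (u b c) != 0) ->
  \sum_(s : 'S_4) y (s 0) (s 1) / u (s 0) (s 1)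
     * ddih4 u z (s 0) (s 1) (s 2%:R) (s 3%:R)
  = \sum_(s : 'S_4) z (s 0) (s 1) / u (s 0) (s 1)
     * ddih4 u y (s 0) (s 1) (s 2%:R) (s 3%:R).
Proof.
move=> uC yC zC u0 K0.
have us (s : 'S_4) p q : p != q -> u (s p) (s q) != 0.
  by move=> pq; rewrite u0 // (inj_eq perm_inj).
have Ks (s : 'S_4) p q r : uniq [:: p; q; r] ->
    heron (u (s p) (s q)) (u (s p) (s r)) (u (s q) (s r)) != 0.
  move=> pqr; apply: K0.
  rewrite -[X in uniq X]/(map s [:: p; q; r]) map_inj_uniq //.
  exact: perm_inj.
have expand (v w : 'I_4 -> 'I_4 -> R) (a b c d : 'I_4) :
  v a b / u a b * ddih4 u w a b c d = v a b * (ddih4 u w a b c d / u a b).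
  by rewrite mulrAC mulrA.
under eq_bigr => s _ do
  rewrite expand ddih_coef !mulrDr !(mulrCA (y _ _)) !mulrA.
under [RHS]eq_bigr => s _ do
  rewrite expand ddih_coef !mulrDr !(mulrCA (z _ _)) !mulrA.
rewrite !big_split /=.
congr (_ + _ + _ + _ + _ + _).
- by apply: eq_bigr => s _; rewrite mulrAC.
- apply: (sum_perm4_edge_swap (t := tperm 1 2%:R)) => //.
  + by left; rewrite tpermL tpermD.
  + by left; rewrite tpermR tpermD.
  + move=> s; rewrite !permM tpermL tpermR !tpermD //.
    by rewrite (uC (s 2%:R) (s 1)) coef_adj_sym ?us //; exact: (Ks s 0 1 2%:R).
- apply: (sum_perm4_edge_swap (t := tperm 1 3%:R)) => //.
  + by left; rewrite tpermL tpermD.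
  + by left; rewrite tpermR tpermD.
  + move=> s; rewrite !permM tpermL tpermR !tpermD //.
    rewrite (uC (s 3%:R) (s 1)) (uC (s 3%:R) (s 2%:R)) (uC (s 2%:R) (s 1)).
    by rewrite coef_adj_sym ?us //; exact: (Ks s 0 1 3%:R).
- apply: (sum_perm4_edge_swap (t := tperm 0 2%:R)) => //.
  + by right; rewrite tpermL tpermD.
  + by right; rewrite tpermR tpermD.
  + move=> s; rewrite !permM tpermL tpermR !tpermD //.
    rewrite (uC (s 2%:R) (s 1)) (uC (s 2%:R) (s 0)) (uC (s 1) (s 0)).
    rewrite coef_adj_sym ?us //.
    by have := Ks s 1 0 2%:R; rewrite (uC (s 1)); apply.
- apply: (sum_perm4_edge_swap (t := tperm 0 3%:R)) => //.
  + by right; rewrite tpermL tpermD.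
  + by right; rewrite tpermR tpermD.
  + move=> s; rewrite !permM tpermL tpermR !tpermD //.
    rewrite (uC (s 3%:R) (s 1)) (uC (s 3%:R) (s 0)) (uC (s 3%:R) (s 2%:R)).
    rewrite (uC (s 1) (s 0)) (uC (s 2%:R) (s 0)).
    rewrite coef_adj_sym ?us //.
    by have := Ks s 1 0 3%:R; rewrite (uC (s 1)); apply.
- apply: (sum_perm4_edge_swap (t := (tperm 0%R 2%:R * tperm 1%R 3%:R)%g)) => //.
  + by left; rewrite !permM tpermL (tpermD (x := 0)) // tpermL tpermD.
  + by left; rewrite !permM tpermR (tpermD (x := 0)) // tpermR tpermD.
  + move=> s; rewrite !permM tpermL tpermR !(tpermD (x := 0)) //.
    rewrite tpermL tpermR !tpermD //.
    rewrite (uC (s 2%:R) (s 0)) (uC (s 2%:R) (s 1)).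
    rewrite (uC (s 3%:R) (s 0)) (uC (s 3%:R) (s 1)).
    by rewrite coef_opp_sym ?us.
Qed.

End PermutationSums.

(** * The matrices of the triangulation and the cancellation across glued faces *)

Section TriangulatedManifold.
Variables (R : realType) (T : tri_data) (x : 'I_(nV T) -> 'I_3 -> R).
Hypotheses (triT : oriented_tri3 T) (genx : general_position x).
Implicit Types (t : 'I_(nT T)) (e i k : 'I_(nE T)) (v w : 'I_(nV T)).

Lemma distE (p q : 'I_3 -> R) : dist p q = Num.sqrt (sqd p q).
Proof.
rewrite /dist !big_ord_recl big_ord0 addr0 addrA; congr Num.sqrt.
by rewrite /sqd /dot -!expr2 !fctE; congr (_ ^+ 2 + _ ^+ 2 + _ ^+ 2);
  congr (_ - _); congr (_ _); apply/val_inj.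
Qed.

Definition corner (y : 'I_(nV T) -> 'I_3 -> R) t (a : 'I_4) := y (tv t a).
Definition tet_sqd t a b := sqd (corner x t a) (corner x t b).

Lemma tet_sqdC t a b : tet_sqd t a b = tet_sqd t b a.
Proof. exact: sqdC. Qed.

Lemma elen_te t a b : a != b -> elen x (te t a b) = Num.sqrt (tet_sqd t a b).
Proof.
case: triT => _ [_ [ev _]] ab; rewrite /elen distE.
by case: (ev t a b ab) => -[-> ->]; rewrite // tet_sqdC.
Qed.

Lemma tet_vol_neq0 t : tet_vol x t != 0.
Proof.
case: triT => tvI _; apply: genx.
by rewrite -[X in uniq X]/(map (tv t) [:: 0; 1; 2%:R; 3%:R]) map_inj_uniq.
Qed.

Definition tet_triple t a b c d := triple (corner x t b - corner x t a)
  (corner x t c - corner x t a) (corner x t d - corner x t a).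

Lemma tet_triple_perm t (s : 'S_4) :
  tet_triple t (s 0) (s 1) (s 2%:R) (s 3%:R) = (-1) ^+ s * (6 * tet_vol x t).
Proof.
by rewrite /tet_triple triple_perm /tet_vol vol4E mulVKf.
Qed.

Lemma tet_triple_neq0 t (a b c d : 'I_4) : uniq [:: a; b; c; d] ->
  tet_triple t a b c d != 0.
Proof.
case/perm4_exists => s [<- <- <- <-].
rewrite tet_triple_perm mulf_eq0 signr_eq0 mulf_eq0 pnatr_eq0 /=.
exact: tet_vol_neq0.
Qed.

Lemma tet_triple_norm t (a b c d : 'I_4) : uniq [:: a; b; c; d] ->
  `|tet_triple t a b c d| = 6 * `|tet_vol x t|.
Proof.
case/perm4_exists => s [<- <- <- <-].
by rewrite tet_triple_perm normrMsign normrM normr_nat.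
Qed.

Lemma tet_sqd_gt0 t (a b : 'I_4) : a != b -> 0 < tet_sqd t a b.
Proof. by move=> ab; exact: sqd_gt0 (tet_triple_neq0 t (uniq_other ab)). Qed.

Lemma tet_heron_gt0 t (a b c : 'I_4) : uniq [:: a; b; c] ->
  0 < heron (tet_sqd t a b) (tet_sqd t a c) (tet_sqd t b c).
Proof.
move=> abc; have ab : a != b.
  by move: abc; rewrite /= inE negb_or -!andbA => /and3P[].
have [h1 h2] := heron_gt0 (tet_triple_neq0 t (uniq_other ab)).
have : c \in [:: a; b; other a b 0; other a b 1].
  by rewrite mem_uniq4 ?uniq_other.
have [ca cb] : c != a /\ c != b.
  by move: abc; rewrite /= !inE negb_or !(eq_sym c) => /and3P[/andP[]].
by rewrite !inE (negPf ca) (negPf cb) /= => /orP[] /eqP ->.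
Qed.

Lemma elen_gt0 e : 0 < elen x e.
Proof.
case: triT => _ [_ [_ [_ [ex _]]]]; have [t [a [b [ab <-]]]] := ex e.
by rewrite elen_te // sqrtr_gt0 tet_sqd_gt0.
Qed.

Definition coord_dir v (c : 'I_3) w : 'I_3 -> R :=
  fun d => ((w == v) && (d == c))%:R.

Lemma coord_dir0 v c w : w != v -> coord_dir v c w = 0.
Proof. by move=> wv; apply/funext => d; rewrite /coord_dir (negPf wv). Qed.

(** The factor [2 * elen x e] passes from the length to its square, whose derivative is free of
    roots. *)
Lemma f2E e v c : 2 * elen x e * f2 x e v c =
  dsqd (x (ev1 e)) (x (ev2 e))
    (coord_dir v c (ev1 e)) (coord_dir v c (ev2 e)).
Proof.
pose p' := coord_dir v c (ev1 e); pose q' := coord_dir v c (ev2 e).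
pose g s := sqd (x (ev1 e) + (fun d => p' d * s))
  (x (ev2 e) + (fun d => q' d * s)).
have g0 : g 0 = sqd (x (ev1 e)) (x (ev2 e)).
  by rewrite /g; congr sqd; apply/funext => d; rewrite !fctE mulr0 addr0.
have fE : (fun s : R => elen (fun w d => x w d
      + (if (w == v) && (d == c) then s else 0)) e) = Num.sqrt \o g.
  apply/funext => s; rewrite /elen distE /=; congr (Num.sqrt (sqd _ _));
  by apply/funext => d; rewrite !fctE /p' /q' /coord_dir;
    case: ifP; rewrite ?mul1r ?mul0r.
have dg : is_derive (0 : R) 1 g (dsqd (x (ev1 e)) (x (ev2 e)) p' q').
  rewrite /g /sqd /dot /dsqd /dot !fctE.
  apply: is_derive_eq; rewrite !fctE /GRing.scale /=; ring.
have l0 := elen_gt0 e; have g0_gt0 : 0 < g 0.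
  by rewrite g0 -sqrtr_gt0 -distE.
have := is_derive1_comp (is_derive1_sqrt g0_gt0) dg.
rewrite /f2 derive1E fE => /@derive_val ->.
rewrite g0 -distE -/(elen x e) mulrA divff ?mul1r //.
by rewrite mulf_neq0 ?gt_eqF.
Qed.

(** Differential d(l^2) = 2 l dl of the squared length of a local edge when the length of [k] grows
    at unit speed; several local edges of [t] may be the same [k]. *)
Definition edge_var t k (a b : 'I_4) : R :=
  2 * elen x (te t a b) * (te t a b == k)%:R.

Lemma edge_varC t k a b : a != b -> edge_var t k a b = edge_var t k b a.
Proof. by case: triT => _ [teC _] ab; rewrite /edge_var teC. Qed.

Lemma sqr_elen t a b : a != b -> elen x (te t a b) ^+ 2 = tet_sqd t a b.
Proof. by move=> ab; rewrite elen_te // sqr_sqrtr ?sqd_ge0. Qed.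

(** The root of [cayley] is 12 |V|, whence 24; the sign carried by the angle turns |V| into V. *)
Lemma is_derive_sdihedral t k a b : a != b ->
  is_derive (0 : R) 1
    (fun s => sdihedral x (fun e => elen x e + (if e == k then s else 0)) t a b)
    (- ddih4 (tet_sqd t) (edge_var t k) a b (other a b 0) (other a b 1)
       / (24 * elen x (te t a b) * tet_vol x t)).
Proof.
move=> ab; have abcd := uniq_other ab.
rewrite /sdihedral /dihedral /=.
move: (other a b 0) (other a b 1) abcd => c d abcd.
have [ac ad bc bd cd] : [/\ a != c, a != d, b != c, b != d & c != d].
  by move: abcd; rewrite /= !inE !negb_or -!andbA; do 6![case/andP=> ?].
pose f e s := elen x e + (if e == k then s else 0).
have f0 p q : p != q -> f (te t p q) 0 ^+ 2 = tet_sqd t p q.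
  by move=> pq; rewrite /f if_same addr0 sqr_elen.
have df e : is_derive (0 : R) 1 (f e) (e == k)%:R.
  rewrite /f; case: (e == k) => /=; apply: is_derive_eq;
  by rewrite ?add0r ?mulr1.
have f_gt0 p q : 0 < f (te t p q) 0 by rewrite /f if_same addr0 elen_gt0.
have [K1 K2] := heron_gt0 (tet_triple_neq0 t abcd).
have G : cayley (tet_sqd t a b) (tet_sqd t a c) (tet_sqd t a d)
    (tet_sqd t b c) (tet_sqd t b d) (tet_sqd t c d)
    = (2 * tet_triple t a b c d) ^+ 2.
  by rewrite cayley_triple /tet_triple; ring.
have := is_derive_dihedral6 (df (te t a b)) (df (te t a c)) (df (te t a d))
  (df (te t b c)) (df (te t b d)) (df (te t c d)).
rewrite !f0 // G => /(_ (f_gt0 _ _) (f_gt0 _ _) (f_gt0 _ _) K1 K2).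
rewrite exprn_even_gt0 // ?mulf_neq0 ?tet_triple_neq0 //= => /(_ isT) D.
have := is_deriveZ (Num.sg (tet_vol x t)) D.
move/is_derive_eq; apply.
rewrite sqrtr_sqr normrM normr_nat tet_triple_norm // /GRing.scale /=.
rewrite /ddih4 /edge_var /f !if_same !addr0.
move: (ddih _ _ _ _ _ _ _ _ _ _ _ _) => X.
have l0 := elen_gt0 (te t a b); have := tet_vol_neq0 t.
case: (ltrgt0P (tet_vol x t)) => // V0 _; rewrite ?(gtr0_sg V0) ?(ltr0_sg V0).
- by field; rewrite ?(gt_eqF l0) ?(gt_eqF V0).
- by field; rewrite ?(gt_eqF l0) ?(lt_eqF V0).
Qed.

Lemma is_derive_bigsum (I : finType) (P : pred I) (h : I -> R -> R)
    (dh : I -> R) (r : R) :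
  (forall j, P j -> is_derive r 1 (h j) (dh j)) ->
  is_derive r 1 (fun s => \sum_(j | P j) h j s) (\sum_(j | P j) dh j).
Proof.
move=> H; have -> : (fun s => \sum_(j | P j) h j s) = \sum_(j | P j) h j.
  by apply/funext => s; rewrite fct_sumE.
apply: (big_rec2 (fun (g : R -> R) d => is_derive r 1 g d)).
  exact: is_derive_cst.
by move=> j d g Pj Dg; apply: is_deriveD Dg; exact: H.
Qed.

(** Contribution of [t] to [f3], as a bilinear form in two variations of squared lengths. Here 192 =
    24 * 2 * 4: 24 from [is_derive_sdihedral], 2 from [edge_var], and 4 permutations per edge. *)
Definition tet_form t (y z : 'I_4 -> 'I_4 -> R) : R :=
  (192 * tet_vol x t)^-1 * \sum_(s : 'S_4)
    y (s 0) (s 1) / tet_sqd t (s 0) (s 1)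
    * ddih4 (tet_sqd t) z (s 0) (s 1) (s 2%:R) (s 3%:R).

(** The condition [te t a b == i] becomes the factor [edge_var t i a b], which puts the row and
    column indices on an equal footing. *)
Lemma f3E i k :
  f3 x i k = \sum_t tet_form t (edge_var t i) (edge_var t k).
Proof.
have D : is_derive (0 : R) 1
    (fun s => angle_defect x (fun e => elen x e + (if e == k then s else 0)) i)
    (- \sum_t \sum_(a < 4) \sum_(b < 4 | (a < b)%N && (te t a b == i))
       (- ddih4 (tet_sqd t) (edge_var t k) a b (other a b 0) (other a b 1)
         / (24 * elen x (te t a b) * tet_vol x t))).
  apply: is_deriveN; do 2![apply: is_derive_bigsum => ? _].
  apply: is_derive_bigsum => b /andP[ab _].
  by apply: is_derive_sdihedral; rewrite -val_eqE /= ltn_eqF.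
rewrite /f3 derive1E (@derive_val _ _ _ _ _ _ _ D) -sumrN.
apply: eq_bigr => t _; rewrite /tet_form.
rewrite (sum_edges_perm4 (F := fun a b c d =>
   edge_var t i a b / tet_sqd t a b
   * ddih4 (tet_sqd t) (edge_var t k) a b c d)).
- rewrite -sumrN mulr_sumr mulr_sumr; apply: eq_bigr => a _.
  rewrite big_mkcondr -sumrN mulr_sumr mulr_sumr; apply: eq_bigr => b ab.
  have ab' : a != b by rewrite -val_eqE /= ltn_eqF.
  move: (ddih4 _ _ _ _ _ _) => X.
  have l0 := elen_gt0 (te t a b); have V0 := tet_vol_neq0 t.
  rewrite /edge_var -sqr_elen //; case: (te t a b == i); last first.
    by rewrite !(mulr0, mul0r, oppr0).
  by rewrite /= mulr1; field; rewrite V0 gt_eqF.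
- move=> a b c d; rewrite /= !inE !negb_or -!andbA => /andP[ab _].
  by rewrite ddih4_swap_ab ?(edge_varC _ _ ab) ?(tet_sqdC _ a b).
- move=> a b c d; rewrite /= !inE !negb_or -!andbA andbT => /and5P[_ _ _ _].
  case/andP=> _ cd.
  by rewrite ddih4_swap_cd ?(edge_varC _ _ cd) ?(tet_sqdC _ c d).
Qed.

Lemma f3_sym i k : f3 x i k = f3 x k i.
Proof.
rewrite !f3E; apply: eq_bigr => t _; rewrite /tet_form; congr (_ * _).
apply: ddih4_bilinear_sym.
- exact: tet_sqdC.
- exact: edge_varC.
- exact: edge_varC.
- by move=> a b ab; rewrite gt_eqF // tet_sqd_gt0.
- by move=> a b c abc; rewrite gt_eqF // tet_heron_gt0.
Qed.

Lemma sum_f2_edge_var t v c a b : a != b ->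
  \sum_k f2 x k v c * edge_var t k a b =
  dsqd (corner x t a) (corner x t b)
    (corner (coord_dir v c) t a) (corner (coord_dir v c) t b).
Proof.
move=> ab; rewrite (bigD1 (te t a b)) //= big1 => [|k].
  rewrite addr0 /edge_var eqxx mulr1 mulrC f2E.
  case: triT => _ [_ [ev _]].
  by case: (ev t a b ab) => -[-> ->]; rewrite // dsqdC.
by rewrite eq_sym /edge_var => /negPf ->; rewrite !mulr0.
Qed.

(** The weighted rotation of the face [a b m] about [a b]. The fourth vertex of [t] does not enter,
    so both sides of a glued face give the same value. *)
Definition face_twist i v (c : 'I_3) t a b m : R :=
  edge_var t i a b / tet_sqd t a b *
  twist (corner x t a) (corner x t b) (corner x t m)
    (corner (coord_dir v c) t a) (corner (coord_dir v c) t b)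
    (corner (coord_dir v c) t m).

(** By [ddih_twist] each permutation gives a signed difference of two face terms with factor 4 * 6 /
    192 = 1/8 up to sign. Exchanging positions 2 and 3 flips the sign, so the two sums merge and 1/8
    becomes 1/4. *)
Lemma sum_f3_f2_tet i v c t :
  \sum_k f2 x k v c * tet_form t (edge_var t i) (edge_var t k) =
  - 4^-1 * \sum_(s : 'S_4) (-1) ^+ s * face_twist i v c t (s 0) (s 1) (s 3%:R).
Proof.
pose F (s : 'S_4) (m : 'I_4) :=
  (-1) ^+ s * face_twist i v c t (s 0) (s 1) (s m).
have swap : \sum_(s : 'S_4) F s 2%:R = - \sum_(s : 'S_4) F s 3%:R.
  rewrite (reindex_inj (mulgI (tperm 2%:R 3%:R))) -sumrN /F.
  apply: eq_bigr => s _; rewrite odd_mul_tperm !permM tpermL !tpermD //=.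
  by rewrite signrN mulNr.
transitivity (- 8^-1 * \sum_(s : 'S_4) (F s 3%:R - F s 2%:R)); last first.
  by rewrite sumrB swap /F; field.
under eq_bigr => k _ do rewrite /tet_form mulrCA mulr_sumr.
rewrite -mulr_sumr exchange_big /= !mulr_sumr; apply: eq_bigr => s _.
have sN p q : p != q -> s p != s q by rewrite (inj_eq perm_inj).
have rearr (f y u d : R) : f * (y * u * d) = y * (f * (d * u)) by ring.
under eq_bigr => k _ do rewrite rearr.
rewrite -mulr_sumr /ddih4 ddih_sum !sum_f2_edge_var ?sN // /tet_sqd.
have [K2 K3] := heron_gt0 (tet_triple_neq0 t (perm4_uniq s)).
rewrite ddih_twist ?gt_eqF // -/(tet_triple _ _ _ _ _) tet_triple_perm.
rewrite /F /face_twist -/(tet_sqd _ _ _).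
have V0 := tet_vol_neq0 t.
have u0 : tet_sqd t (s 0) (s 1) != 0 by rewrite gt_eqF // tet_sqd_gt0 ?sN.
move: (tet_vol x t) (tet_sqd _ _ _) (edge_var _ _ _ _) (twist _ _ _ _ _ _)
  (twist _ _ _ _ _ _) ((-1) ^+ s) V0 u0 => V u y r1 r2 sg V0 u0.
by field; rewrite V0 u0.
Qed.

(** A sign-reversing involution on pairs of a tetrahedron and an ordering of its vertices: gluing
    maps are odd and preserve the vertices and edges of the face. *)
Lemma sum_face_twist_eq0 i v c : inner_vertex v ->
  \sum_t \sum_(s : 'S_4)
    (-1) ^+ s * face_twist i v c t (s 0) (s 1) (s 3%:R) = 0.
Proof.
move=> vin; pose G (p : 'I_(nT T) * 'S_4) :=
  (-1) ^+ p.2 * face_twist i v c p.1 (p.2 0) (p.2 1) (p.2 3%:R).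
transitivity (\sum_p G p); first by rewrite pair_big.
(* The term at (t, s) sees the face of [s 0], [s 1], [s 3], the one opposite [s 2]; [h] crosses it,
   or stays put when it lies on the boundary. *)
pose h (p : 'I_(nT T) * 'S_4) :=
  if Defs.glue p.1 (p.2 2%:R) is Some (t', s) then (t', p.2 * s)%g else p.
case: triT => _ [_ [_ [_ [_ gl]]]].
have hK : involutive h.
  case=> t s; rewrite /h /=; case E: (Defs.glue t (s 2%:R)) => [[t' q]|] /=.
    have [_ E' _ _ _] := gl _ _ _ _ E.
    by rewrite permM E' mulgK.
  by rewrite E.
have Gh p : G (h p) = - G p.
  case: p => t s; rewrite /h /G /=.
  have sN p q : p != q -> s p != s q by rewrite (inj_eq perm_inj).
  case E: (Defs.glue t (s 2%:R)) => [[t' q]|] /=.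
    have [_ _ Ev Ee qodd] := gl _ _ _ _ E.
    rewrite odd_permM qodd addbT signrN mulNr; congr (- (_ * _)).
    rewrite /face_twist /tet_sqd /edge_var /corner !permM.
    by rewrite !Ev ?Ee ?sN.
  (* The vertices of a boundary face are boundary vertices, hence differ from the inner vertex [v]
     and do not move. *)
  suff -> : face_twist i v c t (s 0) (s 1) (s 3%:R) = 0 by rewrite mulr0 oppr0.
  have v0 m : m != 2%:R -> corner (coord_dir v c) t (s m) = 0.
    move=> m2; apply: coord_dir0; apply: contraNneq vin => <-.
    apply/existsP; exists t; apply/existsP; exists (s 2%:R).
    by apply/existsP; exists (s m); rewrite E !eqxx sN.
  by rewrite /face_twist !v0 // twist0 mulr0.
have : \sum_p G p = - \sum_p G p.
  by rewrite {1}(reindex_inj (inv_inj hK)) -sumrN; apply: eq_bigr => p _.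
by move/eqP; rewrite -addr_eq0 -mulr2n mulrn_eq0 => /eqP.
Qed.

Lemma sum_f3_f2 i v c : inner_vertex v -> \sum_k f3 x i k * f2 x k v c = 0.
Proof.
move=> vin.
under eq_bigr => k _ do rewrite f3E mulrC mulr_sumr.
rewrite exchange_big /=; under eq_bigr => t _ do rewrite sum_f3_f2_tet.
by rewrite -mulr_sumr sum_face_twist_eq0 // mulr0.
Qed.

Lemma f2_bdry e v c : inner_vertex v -> bdry_edge e -> f2 x e v c = 0.
Proof.
move=> vin /existsP[t /existsP[j /existsP[a /existsP[b]]]].
case/and5P=> gj aj bj ab /eqP et.
have bv m : m != j -> tv t m != v.
  move=> mj; apply: contraNneq vin => <-.
  apply/existsP; exists t; apply/existsP; exists j.
  by apply/existsP; exists m; rewrite gj mj eqxx.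
have l0 := elen_gt0 e; have := f2E e v c.
case: triT => _ [_ [ev _]].
rewrite !coord_dir0; first last.
- by rewrite -et; case: (ev t a b ab) => -[e1 e2]; rewrite ?e1 ?e2 bv.
- by rewrite -et; case: (ev t a b ab) => -[e1 e2]; rewrite ?e1 ?e2 bv.
rewrite /dsqd /dot !fctE !subr0 !mulr0 !addr0 mulr0 => /eqP.
by rewrite !mulf_eq0 pnatr_eq0 (gt_eqF l0) => /eqP.
Qed.

(** Moving an inner vertex changes no boundary edge length, so omitting the boundary edges outside
    [C] leaves the full sum unchanged. *)
Lemma sum_f3_f2_restricted (C : {set 'I_(nE T)}) i v c : inner_vertex v ->
  \sum_(k | inner_edge k || (k \in C)) f3 x i k * f2 x k v c = 0.
Proof.
move=> vin; rewrite -[RHS](sum_f3_f2 i c vin) [LHS]big_mkcond.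
apply: eq_bigr => k _; case: ifPn => //; rewrite negb_or negbK => /andP[kb _].
by rewrite f2_bdry ?mulr0.
Qed.

End TriangulatedManifold.

Unset Implicit Arguments.

Theorem theorem3 (R : realType) (T : tri_data) (x : 'I_(nV T) -> 'I_3 -> R)
    (C D : {set 'I_(nE T)}) :
  oriented_tri3 T ->
  general_position x ->
  (forall e, e \in C -> bdry_edge e) ->
  (forall e, e \in D -> bdry_edge e) ->
  #|C| = #|D| ->
  (* f3 o f2 = 0 *)
  (forall i, inner_edge i || (i \in D) ->
   forall v c, inner_vertex v ->
     \sum_(k | inner_edge k || (k \in C)) f3 x i k * f2 x k v c = 0)
  /\
  (* f4 o f3 = 0 *)
  (forall v c, inner_vertex v ->
   forall k, inner_edge k || (k \in C) ->
     \sum_(j | inner_edge j || (j \in D)) f4 x v c j * f3 x j k = 0).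
Proof.
move=> triT genx _ _ _; split=> [i _ v c vin|v c vin k _].
  exact: sum_f3_f2_restricted.
(* By the symmetry of [f3], this entry of f4 o f3 is minus the transposed entry of f3 o f2 formed
   with [D] in place of [C]. *)
rewrite -[RHS]oppr0 -[X in _ = - X](sum_f3_f2_restricted triT genx D k c vin).
rewrite -sumrN; apply: eq_bigr => j _.
by rewrite /f4 mulNr mulrC f3_sym.
Qed.
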